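(* For every integer $t\ge3$ the following are equivalent: (i) $\alpha(H)\ge\frac{\mathsf{v}(H)}{t-1}$ for every non-null graph $H$ with no $K_t$ minor; (ii) $\rho(\mathcal{F})\le\frac{t-2}{t-1}$ for every minor-closed class of graphs $\mathcal{F}$ such that $\mathcal{C}_t\not\subseteq\mathcal{F}$.
   Context: All graphs are finite and simple. $\mathcal{C}_t$ is the class of all graphs in which every connected component has at most $t$ vertices. $\mathsf{d}(G)=\mathsf{e}(G)/\mathsf{v}(G)$. A jumbled model of $H$ in $G$ is a map $\mu$ from $V(H)$ to subsets of $V(G)$ such that each $G[\mu(v)]$ is connected (and nonempty) and for every edge $uv\in E(H)$ some edge of $G$ joins $\mu(u)$ and $\mu(v)$ (overlaps allowed); $\mu^{\#}(x)=|\{v:x\in\mu(v)\}|$. $\mathrm{Vol}_H(G)$ is the supremum of $\sum_i\alpha_i$ over finitely many reals $\alpha_i\ge0$ and jumbled models $\mu_i$ of $H$ in $G$ with $\sum_i\alpha_i\mu_i^{\#}(x)\le1$ for all $x$; $c_f(H)=\sup_G\mathsf{d}(G)/\mathrm{Vol}_H(G)$ over non-null $G$. The nucleus $\mathrm{nuc}(\mathcal{F})$ is the set of graphs $H$ with $kH\in\mathcal{F}$ for all $k\in\mathbb{N}$, and $\rho(\mathcal{F})=\sup_{H\in\mathrm{nuc}(\mathcal{F})}c_f(H)/\mathsf{v}(H)$ (over non-null $H$). *)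

(* Defs.v *)
From mathcomp Require Import all_boot all_order all_algebra.

Set Implicit Arguments.
Unset Strict Implicit.
Unset Printing Implicit Defensive.

Import Order.TTheory GRing.Theory Num.Theory.

(* The null graph (no vertices) is an [sgraph]; non-nullity is always stated
   explicitly. *)
Record sgraph := SGraph {
  vertex :> finType;
  adj : rel vertex;
  adj_sym : symmetric adj;
  adj_irrefl : irreflexive adj }.

Definition edges (G : sgraph) : {set {set G}} :=
  [set [set p.1; p.2] | p : G * G & adj p.1 p.2].

Definition induced_connected (G : sgraph) (S : {set G}) : bool :=
  (S != set0) &&
  [forall x in S, forall y in S,
     connect [rel a b : G | [&& a \in S, b \in S & adj a b]] x y].

Definition independent (G : sgraph) (S : {set G}) : bool :=
  [forall x in S, forall y in S, ~~ adj x y].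

Definition alpha (G : sgraph) : nat := \max_(S : {set G} | independent S) #|S|.

Definition component (G : sgraph) (x : G) : {set G} := [set y | connect (@adj G) x y].

Definition jumbled_model (G H : sgraph) (mu : {ffun H -> {set G}}) : bool :=
  [forall v, induced_connected (mu v)] &&
  [forall u, forall v, adj u v ==>
     [exists x in mu u, exists y in mu v, adj x y]].

Definition multiplicity (G H : sgraph) (mu : {ffun H -> {set G}}) (x : G) : nat :=
  #|[set v | x \in mu v]|.

(* [H] is a minor of [G]: a model with pairwise disjoint branch sets. In
   particular every graph isomorphic to [G] is a minor of [G]. *)
Definition is_minor (G H : sgraph) : Prop :=
  exists mu : {ffun H -> {set G}},
    jumbled_model mu /\ forall u v, u != v -> [disjoint mu u & mu v].

Definition complete_adj (t : nat) : rel 'I_t := fun i j => i != j.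

Lemma complete_sym t : symmetric (@complete_adj t).
Proof. by move=> i j; rewrite /complete_adj eq_sym. Qed.

Lemma complete_irrefl t : irreflexive (@complete_adj t).
Proof. by move=> i; rewrite /complete_adj eqxx. Qed.

Definition complete (t : nat) : sgraph :=
  SGraph (@complete_sym t) (@complete_irrefl t).

Definition copies_adj (k : nat) (H : sgraph) : rel ('I_k * H)%type :=
  fun p q => (p.1 == q.1) && adj p.2 q.2.

Lemma copies_sym k H : symmetric (@copies_adj k H).
Proof. by move=> p q; rewrite /copies_adj eq_sym adj_sym. Qed.

Lemma copies_irrefl k H : irreflexive (@copies_adj k H).
Proof. by move=> p; rewrite /copies_adj adj_irrefl andbF. Qed.

Definition copies (k : nat) (H : sgraph) : sgraph :=
  SGraph (@copies_sym k H) (@copies_irrefl k H).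

Definition graph_class := sgraph -> Prop.

Definition minor_closed (F : graph_class) : Prop :=
  forall G H, F G -> is_minor G H -> F H.

Definition bounded_components (t : nat) : graph_class :=
  fun G => forall x : G, #|component x| <= t.

Definition nucleus (F : graph_class) : graph_class :=
  fun H => forall k, F (copies k H).

From mathcomp Require Import boolp classical_sets reals constructive_ereal ereal.

Local Open Scope classical_set_scope.
Local Open Scope ring_scope.

Definition density (R : realType) (G : sgraph) : R := #|edges G|%:R / #|G|%:R.

Definition fractional_packing (R : realType) (H G : sgraph) (n : nat) (a : 'I_n -> R)
    (mu : 'I_n -> {ffun H -> {set G}}) : Prop :=
  [/\ forall i, 0 <= a i,
      forall i, jumbled_model (mu i) &
      forall x, \sum_(i < n) a i * (multiplicity (mu i) x)%:R <= 1].

Definition Vol (R : realType) (H G : sgraph) : \bar R :=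
  ereal_sup [set s | exists (n : nat) (a : 'I_n -> R)
                            (mu : 'I_n -> {ffun H -> {set G}}),
    fractional_packing a mu /\ s = (\sum_(i < n) a i)%:E].

(* If [G] has an edge then [Vol H G > 0], since every [mu v] may be the set of
   its two ends. The only case where [Vol H G = 0] is thus [density G = 0], and
   the quotient is then [0 * +oo = 0], which does not affect the supremum. *)
Definition cf (R : realType) (H : sgraph) : \bar R :=
  ereal_sup [set s | exists G : sgraph,
    (0 < #|G|)%N /\ s = ((density R G)%:E / Vol R H G)%E].

(* This is [-oo] if the nucleus contains no non-null graph. *)
Definition rho (R : realType) (F : graph_class) : \bar R :=
  ereal_sup [set s | exists H : sgraph,
    [/\ nucleus F H, (0 < #|H|)%N & s = (cf R H / (#|H|%:R)%:E)%E]].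

(* Main.v *)
(** Put [q = (t-2)/(t-1)].  Condition (i) says that a [K_t]-minor-free [H] has vertex cover
    number at most [q v(H)].  On large stars the ratio of density and volume tends to at least
    the vertex cover number, which gives (ii) => (i), since the class of [K_t]-minor-free
    graphs is its own nucleus.

    Conversely, if [F] misses a graph of [C_t], then the nucleus of [F] consists of
    [K_t]-minor-free graphs, and iterating (i) in the uncoloured part of such an [H] yields a
    proper partial colouring whose uncoloured part shrinks by the factor [q] with each colour.
    By linear programming duality (in an approximate form) it suffices to find, for every
    vertex weighting [w] of [G], a model of [H] of weight at most
    [q v(H) v(G) w(G) / e(G)].  In a clique of [G] with weights [w_0 <= ... <= w_(k-1)], put
    colour [i] on the [i]-th vertex and the uncoloured vertices on the two lightest; the cost is
    at most [v(H)] times [clique_cost].  That some clique is cheap enough is a weighted version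
    of Turan's theorem, proved in the manner of Motzkin and Straus. *)

Require Import Defs.
From mathcomp Require Import all_boot all_order all_algebra.
From mathcomp Require Import ring lra zify.

Set Implicit Arguments.
Unset Strict Implicit.
Unset Printing Implicit Defensive.

Import Order.TTheory GRing.Theory Num.Theory.

(** * Minors and models *)

Lemma connect_preserves (T : finType) (e : rel T) (P : T -> Prop) x y :
  connect e x y -> P x -> (forall a b, e a b -> P a -> P b) -> P y.
Proof.
move=> /connectP[p ep ->] Px Pe; elim: p x ep Px => //= z p IH x /andP[exz ep] Px.
exact: IH ep (Pe _ _ exz Px).
Qed.

Lemma connect_homo (T U : finType) (e : rel T) (e' : rel U) (f : T -> U) x y :
  (forall a b, e a b -> connect e' (f a) (f b)) ->
  connect e x y -> connect e' (f x) (f y).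
Proof.
move=> ee' exy; apply: (connect_preserves (P := fun z => connect e' (f x) (f z)) exy) => //.
by move=> a b /ee' ab xa; apply: connect_trans ab.
Qed.

Definition adj_in (G : sgraph) (S : {set G}) : rel G :=
  [rel a b : G | [&& a \in S, b \in S & adj a b]].

Lemma adj_in_sym (G : sgraph) (S : {set G}) : connect_sym (adj_in S).
Proof. by apply: sym_connect_sym => a b; rewrite /adj_in /= adj_sym andbCA. Qed.

Lemma induced_connectedI (G : sgraph) (S : {set G}) x : x \in S ->
  (forall y, y \in S -> connect (adj_in S) x y) -> induced_connected S.
Proof.
move=> xS Sx; apply/andP; split; first by apply/set0Pn; exists x.
apply/forallP => y; apply/implyP => yS; apply/forallP => z; apply/implyP => zS.
by apply: (@connect_trans _ _ x); [rewrite adj_in_sym; apply: Sx | apply: Sx].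
Qed.

Lemma induced_connected_ex (G : sgraph) (S : {set G}) :
  induced_connected S -> exists x, x \in S.
Proof. by case/andP => /set0Pn. Qed.

Lemma induced_connectedE (G : sgraph) (S : {set G}) x y :
  induced_connected S -> x \in S -> y \in S -> connect (adj_in S) x y.
Proof. by case/andP => _ /forall_inP H xS yS; have /forall_inP := H x xS; apply. Qed.

Lemma induced_connected1 (G : sgraph) (x : G) : induced_connected [set x].
Proof. by apply: (@induced_connectedI _ _ x) => [|y]; rewrite inE // => /eqP->. Qed.

Lemma induced_connected2 (G : sgraph) (x y : G) : adj x y -> induced_connected [set x; y].
Proof.
move=> xy; apply: (@induced_connectedI _ _ x) => [|z]; rewrite !inE ?eqxx //.
by case/orP => /eqP-> //; apply: connect1; rewrite /adj_in /= !inE !eqxx orbT.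
Qed.

Lemma jumbledP (G H : sgraph) (mu : {ffun H -> {set G}}) :
  reflect ((forall v, induced_connected (mu v)) /\
           forall u v, adj u v -> exists x y, [/\ x \in mu u, y \in mu v & adj x y])
          (jumbled_model mu).
Proof.
apply: (iffP andP) => -[].
  move=> /forallP cmu /forallP amu; split=> // u v uv.
  have /forallP/(_ v)/implyP/(_ uv)/exists_inP[x xu /exists_inP[y yv xy]] := amu u.
  by exists x, y.
move=> cmu amu; split; first exact/forallP.
apply/forallP => u; apply/forallP => v; apply/implyP => /amu[x [y [xu yv xy]]].
by apply/exists_inP; exists x => //; apply/exists_inP; exists y.
Qed.

Lemma embedding_minor (G H : sgraph) (f : H -> G) :
  injective f -> (forall u v, adj u v -> adj (f u) (f v)) -> is_minor G H.
Proof.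
move=> f_inj f_adj; exists [ffun u => [set f u]]; split.
  apply/jumbledP; split=> [v|u v /f_adj uv]; first by rewrite ffunE induced_connected1.
  by exists (f u), (f v); rewrite !ffunE !inE !eqxx.
by move=> u v uv; rewrite !ffunE disjoints1 inE; apply: contra uv => /eqP/f_inj->.
Qed.

(** A path in [S] is followed one edge at a time: each edge of [H] yields an edge of [G] between the
    two branch sets, and inside a branch set one moves freely. The invariant is that the whole
    current branch set is reachable. *)
Lemma connected_bigcup (G H : sgraph) (mu : {ffun H -> {set G}}) (S : {set H}) :
  jumbled_model mu -> induced_connected S -> induced_connected (\bigcup_(u in S) mu u).
Proof.
move=> /jumbledP[cmu amu] cS; set T := \bigcup_(u in S) mu u.
have [u0 u0S] := induced_connected_ex cS; have [x xu0] := induced_connected_ex (cmu u0).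
have inT u y : u \in S -> y \in mu u -> y \in T by move=> uS yu; apply/bigcupP; exists u.
have step u a b : u \in S -> a \in mu u -> b \in mu u -> connect (adj_in T) a b.
  move=> uS au bu; apply: (connect_homo (f := id)) (induced_connectedE (cmu u) au bu).
  by move=> c d /= /and3P[cu du cd]; apply: connect1; rewrite /adj_in /= !(inT u).
apply: (@induced_connectedI _ _ x); first exact: inT xu0.
move=> y /bigcupP[u uS yu].
have /= P := connect_preserves (P := fun v => v \in S -> forall z, z \in mu v ->
  connect (adj_in T) x z) (induced_connectedE cS u0S uS).
apply: P uS y yu => [_ z zu0|a b /and3P[aS bS ab] IH _ z zb]; first exact: step zu0.
have [c [d [ca db cd]]] := amu _ _ ab.
apply: connect_trans (IH aS c ca) _; apply: (@connect_trans _ _ d); last exact: (step b).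
by apply: connect1; rewrite /adj_in /= (inT a) ?(inT b).
Qed.

Lemma minor_trans (G H K : sgraph) : is_minor G H -> is_minor H K -> is_minor G K.
Proof.
move=> [mu [jmu dmu]] [nu [/jumbledP[cnu anu] dnu]].
exists [ffun v => \bigcup_(u in nu v) mu u]; split.
  apply/jumbledP; split=> [v|u v /anu[a [b [au bv ab]]]]; first by rewrite ffunE connected_bigcup.
  have /jumbledP[_ /(_ _ _ ab)[x [y [xa yb xy]]]] := jmu.
  by exists x, y; rewrite !ffunE; split=> //; apply/bigcupP; [exists a | exists b].
move=> u v uv; rewrite !ffunE -setI_eq0; apply/eqP/setP => x; rewrite !inE.
apply/andP => -[/bigcupP[a au xa] /bigcupP[b bv xb]].
have [ab|ab] := eqVneq a b; first by move: (disjointFr (dnu u v uv) au); rewrite ab bv.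
by move: (disjointFr (dmu a b ab) xa); rewrite xb.
Qed.

Lemma minor_refl (G : sgraph) : is_minor G G.
Proof. exact: (embedding_minor (f := id)). Qed.

Lemma copies_minor k (G H : sgraph) : is_minor G H -> is_minor (copies k G) (copies k H).
Proof.
move=> [mu [/jumbledP[cmu amu] dmu]].
pose nu (p : copies k H) : {set copies k G} := [set (p.1, x) | x in mu p.2].
have nuE p (x : copies k G) : (x \in nu p) = (x.1 == p.1) && (x.2 \in mu p.2).
  apply/imsetP/idP => [[y yp ->]|]; first by rewrite /= eqxx.
  by case: x => i x /= /andP[/eqP-> xp]; exists x.
exists [ffun p => nu p]; split.
  apply/jumbledP; split=> [p|p r /andP[/eqP pr /amu[x [y [xp yr xy]]]]].
    rewrite ffunE; have [x xp] := induced_connected_ex (cmu p.2).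
    apply: (@induced_connectedI (copies k G) (nu p) (p.1, x)); first by rewrite nuE eqxx.
    move=> [i y]; rewrite nuE /= => /andP[/eqP-> yp].
    apply: (connect_homo (f := fun z => (p.1, z) : copies k G))
      (induced_connectedE (cmu p.2) xp yp) => a b /= /and3P[ap bp ab].
    by apply: connect1; rewrite /adj_in /= !nuE /= /copies_adj /= !eqxx ap bp.
  exists (p.1, x), (r.1, y).
  by rewrite !ffunE !nuE !eqxx xp yr; split=> //; apply/andP; split => //; apply/eqP.
move=> p r pr; rewrite !ffunE -setI_eq0; apply/eqP/setP => x; rewrite in_set0 inE !nuE.
apply/negP => /andP[/andP[/eqP xp xp2] /andP[/eqP xr xr2]].
have pr2 : p.2 != r.2.
  apply: contra pr => /eqP pr2; apply/eqP; case: p r xp xr pr2 {xp2 xr2} => i u [j v] /=.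
  by move=> <- <- ->.
by move: (disjointFr (dmu _ _ pr2) xp2); rewrite xr2.
Qed.

(** A connected branch set stays in one copy of [H]. Branch sets of a clique touch pairwise, so all
    lie in the copy met by branch set [0], and projecting to [H] gives a model there. *)
Lemma complete_minor_copies t k (H : sgraph) :
  is_minor (copies k H) (complete t) -> (0 < t)%N -> is_minor H (complete t).
Proof.
case: t => // t [mu [/jumbledP[cmu amu] dmu]] _.
have same v x y : x \in mu v -> y \in mu v -> x.1 = y.1.
  move=> xv yv; have /= c := connect_preserves (P := fun z : copies k H => x.1 = z.1)
    (induced_connectedE (cmu v) xv yv).
  by apply: c => // a b /and3P[_ _ /andP[/eqP-> _]].
have [x0 x00] := induced_connected_ex (cmu (ord0 : 'I_t.+1)); set i := x0.1.
have all_i v x : x \in mu v -> x.1 = i.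
  have [->|v0] := eqVneq v (ord0 : complete t.+1); first by move/same; apply.
  move=> xv; have [a [b [av b0 /andP[/eqP ab _]]]] := amu v (ord0 : 'I_t.+1) v0.
  by rewrite (same _ _ _ xv av) ab; apply: same b0 x00.
pose nu (v : complete t.+1) : {set H} := [set h | (i, h) \in mu v].
exists [ffun v => nu v]; split.
  apply/jumbledP; split=> [v|u v /amu[x [y [xu yv /andP[_ xy]]]]].
    rewrite ffunE; have [x xv] := induced_connected_ex (cmu v).
    have xi := all_i _ _ xv.
    have snd_in z : z \in mu v -> z.2 \in nu v.
      by move=> zv; rewrite inE -(all_i _ _ zv) -surjective_pairing.
    apply: (@induced_connectedI _ _ x.2); first exact: snd_in.
    move=> y; rewrite inE => yv.
    apply: (connect_homo (f := snd)) (induced_connectedE (cmu v) xv yv).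
    by move=> a b /= /and3P[av bv /andP[_ ab]]; apply: connect1; rewrite /adj_in /= !snd_in.
  exists x.2, y.2; rewrite !ffunE !inE -{1}(all_i _ _ xu) -(all_i _ _ yv).
  by rewrite -!surjective_pairing.
move=> u v uv; rewrite !ffunE -setI_eq0; apply/eqP/setP => x; rewrite !inE.
by apply/andP => -[xu xv]; move: (disjointFr (dmu _ _ uv) xu); rewrite xv.
Qed.

(** Each component embeds in its own copy of the clique, and there are at most [#|G|] components. *)
Lemma bounded_components_minor t (G : sgraph) : bounded_components t G ->
  is_minor (copies #|G| (complete t)) G.
Proof.
move=> Gt; have Gsym := sym_connect_sym (@adj_sym G).
have lt_ix (x : G) : index x (enum (component x)) < t.
  by apply: leq_trans (Gt x); rewrite cardE index_mem mem_enum inE.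
(* The copy is named by the root of the component, the clique vertex by the position of [x] in the
   enumeration of its component. *)
pose f (x : G) : copies #|G| (complete t) :=
  (enum_rank (fingraph.root (@adj G) x), Ordinal (lt_ix x)).
have same x y : fingraph.root (@adj G) x = fingraph.root (@adj G) y -> component x = component y.
  move=> rxy; apply/setP => z; rewrite !inE; apply: (same_connect Gsym).
  by apply/(fingraph.rootP Gsym).
have f_inj : injective f.
  move=> x y fxy; have rxy : fingraph.root (@adj G) x = fingraph.root (@adj G) y.
    by apply: enum_rank_inj; apply: (congr1 (@fst _ _) fxy).
  have := congr1 (fun p : copies #|G| (complete t) => val p.2) fxy.
  rewrite /= (same _ _ rxy) => ixy.
  have xy : x \in enum (component y) by rewrite mem_enum inE Gsym; apply/(fingraph.rootP Gsym).
  by apply: (index_inj x xy _ ixy); rewrite mem_enum inE connect0.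
apply: (embedding_minor f_inj) => u v uv.
have ruv : fingraph.root (@adj G) u = fingraph.root (@adj G) v by apply/(fingraph.rootP Gsym)/connect1.
rewrite /= /copies_adj /= ruv eqxx /= /complete_adj; apply: contraTneq uv => e.
have -> : u = v by apply: f_inj; rewrite /f ruv e.
by rewrite adj_irrefl.
Qed.

(** * Induced subgraphs *)

Section InducedSubgraph.
Variables (G : sgraph) (S : {set G}).

Definition induced_adj : rel {x | x \in S} := fun u v => adj (val u) (val v).

Lemma induced_sym : symmetric induced_adj.
Proof. by move=> u v; apply: adj_sym. Qed.

Lemma induced_irrefl : irreflexive induced_adj.
Proof. by move=> u; apply: adj_irrefl. Qed.

Definition induced : sgraph := SGraph induced_sym induced_irrefl.

Lemma induced_minor : is_minor G induced.
Proof. by apply: (@embedding_minor G induced val) => //; apply: val_inj. Qed.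

Lemma card_induced : #|induced| = #|S|.
Proof. by rewrite /= card_sig; apply: eq_card => x; rewrite inE. Qed.

Lemma induced_independent :
  exists I : {set G}, [/\ I \subset S, independent I & #|I| = alpha induced].
Proof.
have [J Jind ->] : {J : {set induced} | independent J & alpha induced = #|J|}.
  apply: eq_bigmax_cond; apply/card_gt0P; exists set0; rewrite unfold_in.
  by apply/forall_inP => x; rewrite inE.
exists [set val x | x in J]; split; last by rewrite card_imset //; apply: val_inj.
  by apply/subsetP => _ /imsetP[x _ ->]; apply: valP.
apply/forall_inP => _ /imsetP[x xJ ->]; apply/forall_inP => _ /imsetP[y yJ ->].
by move/forall_inP: Jind => /(_ x xJ)/forall_inP/(_ y yJ).
Qed.

End InducedSubgraph.

(** * Stars *)

Section Star.
Variable n : nat.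

Definition star_adj : rel (option 'I_n) := fun x y => isSome x != isSome y.

Lemma star_sym : symmetric star_adj.
Proof. by move=> x y; rewrite /star_adj eq_sym. Qed.

Lemma star_irrefl : irreflexive star_adj.
Proof. by move=> x; rewrite /star_adj eqxx. Qed.

Definition star : sgraph := SGraph star_sym star_irrefl.

Lemma card_star : #|star| = n.+1.
Proof. by rewrite /= card_option card_ord. Qed.

Lemma card_star_edges : n <= #|edges star|.
Proof.
rewrite -[leqLHS](card_ord n); pose f (i : 'I_n) : {set star} := [set None; Some i].
have f_inj : injective f.
  move=> i j /setP/(_ (Some i)); rewrite !inE eqxx /= => /esym/eqP.
  by case.
rewrite -(card_imset (mem 'I_n) f_inj); apply: subset_leq_card.
by apply/subsetP => _ /imsetP[i _ ->]; apply/imsetP; exists (None, Some i); rewrite ?inE.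
Qed.

(* A branch set avoiding the centre is a single leaf, so the branch sets avoiding
   the centre are indexed by an independent set. *)
Lemma star_multiplicity (H : sgraph) (mu : {ffun H -> {set star}}) :
  jumbled_model mu -> (#|H| - alpha H <= multiplicity mu (None : option 'I_n))%N.
Proof.
move=> /jumbledP[cmu amu]; rewrite leq_subLR.
pose J := [set v | None \notin mu v].
have -> : #|H| = (#|J| + multiplicity mu (None : option 'I_n))%N.
  rewrite addnC -(cardsC [set v | None \in mu v]); congr (_ + #|pred_of_set _|)%N.
  by apply/setP => v; rewrite !inE.
rewrite leq_add2r /alpha; apply: (leq_bigmax_cond (F := fun S : {set H} => #|S|)).
apply/forall_inP => u; rewrite inE => u0; apply/forall_inP => v; rewrite inE => v0.
apply/negP => /amu[x [y [xu yv]]]; case: x xu => [i _|xu]; last by rewrite xu in u0.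
by case: y yv => [j _|yv]; last by rewrite yv in v0.
Qed.

End Star.

(** An edge is the image of two ordered pairs, distinct because adjacency is irreflexive. *)
Lemma card_edges_adj (G : sgraph) : (2 * #|edges G| <= #|[set p : G * G | adj p.1 p.2]|)%N.
Proof.
set A := [set p : G * G | adj p.1 p.2]; pose f (p : G * G) : {set G} := [set p.1; p.2].
have edgesE : edges G = f @: A.
  by apply/setP => e; apply/imsetP/imsetP => -[p pA ->]; exists p; rewrite // inE in pA *.
rewrite -[#|A|]sum1_card (partition_big_imset f) -edgesE /= mulnC -sum_nat_const.
apply: leq_sum => e; rewrite edgesE => /imsetP[[x y] xyA ->]; rewrite inE /= in xyA.
have xy : x != y by apply: contraTneq xyA => ->; rewrite adj_irrefl.
rewrite sum1_card; apply: (@leq_trans #|[set (x, y); (y, x)]|).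
  by rewrite cards2 xpair_eqE negb_and xy.
apply: subset_leq_card; apply/subsetP => p; rewrite !inE => /orP[]/eqP->.
  by rewrite unfold_in /= !inE xyA eqxx.
by rewrite unfold_in /= !inE /= adj_sym xyA /f setUC /= eqxx.
Qed.

Local Open Scope ring_scope.

(** * A weighted Turan theorem *)

Section CliqueInequality.
Variables (R : realFieldType) (q : R).
Hypothesis q_half : 1 <= 2 * q.
Hypothesis q_le1 : q <= 1.

Let q_ge0 : 0 <= q. Proof. by move: q_half => ?; lra. Qed.
Let qX_ge0 i : 0 <= q ^+ i. Proof. exact: exprn_ge0. Qed.

(* A power of [q] lies below its chord over the interval [1/2, 1]. *)
Lemma exp_le_chord m : q ^+ m.+1 <= 2 * q - 1 + (1 - q) / 2 ^+ m.
Proof.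
move: q_half q_le1 => hq hq1.
elim: m => [|m IH]; first by rewrite expr1 expr0 divr1; lra.
rewrite exprS; have := ler_wpM2l q_ge0 IH; move/le_trans; apply.
rewrite exprS invfM; set h := (2 ^+ m)^-1.
have h0 : 0 <= h by rewrite invr_ge0 exprn_ge0.
have h1 : h <= 1 by rewrite invf_le1 ?exprn_gt0 // exprn_ege1 // ler1n.
rewrite -subr_ge0.
have -> : 2 * q - 1 + (1 - q) * (2^-1 * h) - q * (2 * q - 1 + (1 - q) * h)
  = (1 - q) * (2 * q - 1) * (1 - 2^-1 * h) by field.
by rewrite !mulr_ge0 //; lra.
Qed.

(** Multiplying the chord bound by [m] leaves the error [(1 - q) * m / 2 ^+ m], at most [1 - q]
    since [m <= 2 ^ m]. *)
Lemma mul_exp_le m : m%:R * q ^+ m.+1 <= m.+1%:R * (2 * q - 1) + 1.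
Proof.
move: q_half q_le1 => hq hq1.
have m0 : 0 <= m%:R :> R by [].
have := ler_wpM2l m0 (exp_le_chord m); move/le_trans; apply.
have mle : m%:R / 2 ^+ m <= 1 :> R.
  by rewrite ler_pdivrMr ?exprn_gt0 // mul1r -natrX ler_nat ltnW // ltn_expl.
rewrite mulrDr mulrCA mulrC -natr1.
have : (1 - q) * (m%:R / 2 ^+ m) <= (1 - q) * 1 by rewrite ler_wpM2l //; lra.
lra.
Qed.

(** These are the partial sums of the coefficients [g] in [clique_inequality]; the last two summands
    correct the indices 0 and 1. For [m >= 3], replacing [q ^+ k] by the larger [q ^+ m] reduces the
    claim to [mul_exp_le] at [m - 1]. *)
Lemma prefix_ge0 m k : (0 < m <= k)%N ->
  0 <= m%:R * (2 * q - 1 - q ^+ k) + 2 * (1 - q ^+ m) + (q ^+ k - 1)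
       + (1 < m)%:R * (2 * q ^+ k).
Proof.
move: q_half q_le1 => hq hq1.
case: m => [//|[|[|m]]] /andP[_ mk] /=.
- by rewrite expr1; lra.
- rewrite expr2; have := qX_ge0 k; have : 0 <= q * (1 - q) by rewrite mulr_ge0 //; lra.
  lra.
rewrite mul1r; have qkm : q ^+ k <= q ^+ m.+3 by rewrite ler_wiXn2l.
have := mul_exp_le m.+2.
have : m%:R * q ^+ k <= m%:R * q ^+ m.+3 by rewrite ler_wpM2l.
rewrite -!natr1; lra.
Qed.

Lemma abel_ge0 (r g : nat -> R) k :
  (forall i, (i < k)%N -> 0 <= r i) ->
  (forall i, (i.+1 < k)%N -> r i.+1 <= r i) ->
  (forall m, (0 < m <= k)%N -> 0 <= \sum_(i < m) g i) ->
  0 <= \sum_(i < k) r i * g i.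
Proof.
move=> r0 rdec G0.
suff H m : (m < k)%N -> r m * \sum_(i < m.+1) g i <= \sum_(i < m.+1) r i * g i.
  case: k r0 rdec G0 H => [|k] r0 rdec G0 H; first by rewrite big_ord0.
  by apply: le_trans (H k _) => //; rewrite mulr_ge0 ?r0 ?G0 ?ltnSn //=.
elim: m => [|m IH] mk; first by rewrite !big_ord1.
rewrite big_ord_recr [leRHS]big_ord_recr /= mulrDr lerD2r.
apply: le_trans (IH (ltnW mk)); apply: ler_wpM2r (rdec _ mk).
by apply: G0; rewrite /= ltnW.
Qed.

Lemma sum_geometric k : \sum_(i < k) (1 - q) * q ^+ i = 1 - q ^+ k.
Proof.
elim: k => [|k IH]; first by rewrite big_ord0 expr0 subrr.
by rewrite big_ord_recr /= IH exprS; ring.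
Qed.

(* Since [r] is nonincreasing with sum 1, the sum of its squares is at most [r 0];
   what remains is linear in [r], and Abel summation reduces it to [prefix_ge0]. *)
Lemma clique_inequality (r : nat -> R) k : (1 < k)%N ->
  (forall i, (i < k)%N -> 0 <= r i) ->
  (forall i, (i.+1 < k)%N -> r i.+1 <= r i) ->
  \sum_(i < k) r i = 1 ->
  (1 + q ^+ k) * (1 + \sum_(i < k) r i ^+ 2)
  <= 2 * (q + (1 - q) * (\sum_(i < k) q ^+ i * r i) + q ^+ k * (r 0%N + r 1%N)).
Proof.
move: q_half q_le1 => hq hq1.
move=> k1 r0 rdec r1.
have le_r0 i : (i < k)%N -> r i <= r 0%N.
  by elim: i => [//|i IH] ik; apply: le_trans (rdec i ik) (IH (ltnW ik)).
have sq : \sum_(i < k) r i ^+ 2 <= r 0%N.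
  rewrite -[leRHS]mulr1 -r1 mulr_sumr; apply: ler_sum => i _.
  by rewrite expr2 ler_wpM2r ?r0 ?le_r0.
(* Coefficient of [r i] in the right side minus [(1 + q ^+ k) * (1 + r 0)], the constant term being
   spread over all [i] by [\sum r = 1]. *)
pose g (i : nat) : R := 2 * q - 1 - q ^+ k + 2 * ((1 - q) * q ^+ i)
  + (i == 0)%:R * (q ^+ k - 1) + (i == 1)%:R * (2 * q ^+ k).
have point m (j : nat) (a : R) : \sum_(i < m) (i == j :> nat)%:R * a = (j < m)%:R * a.
  rewrite -mulr_suml; congr (_ * a); case: (ltnP j m) => jm.
    rewrite (bigD1 (Ordinal jm)) //= eqxx big1 ?addr0 // => i.
    by rewrite -val_eqE /= => /negPf->.
  rewrite big1 // => i _; case: eqP => // ij; by have := ltn_ord i; rewrite ij ltnNge jm.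
have G m : (0 < m <= k)%N -> 0 <= \sum_(i < m) g i.
  move=> mk; have := prefix_ge0 mk; congr (0 <= _).
  rewrite 3!big_split /= !point -mulr_sumr sum_geometric sumr_const card_ord.
  by case/andP: mk => -> _; rewrite mul1r -[(_ - _) *+ m]mulr_natl.
have := abel_ge0 r0 rdec G.
have -> : \sum_(i < k) r i * g i = 2 * q - 1 - q ^+ k
    + 2 * (1 - q) * (\sum_(i < k) q ^+ i * r i) + r 0%N * (q ^+ k - 1) + r 1%N * (2 * q ^+ k).
  have pick (j : nat) (a : R) : (j < k)%N -> \sum_(i < k) r i * ((i == j :> nat)%:R * a) = r j * a.
    move=> jk; rewrite (bigD1 (Ordinal jk)) //= eqxx mul1r big1 ?addr0 // => i.
    by rewrite -val_eqE /= => /negPf->; rewrite mul0r mulr0.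
  rewrite /g; under eq_bigr => i _ do rewrite 3!mulrDr.
  rewrite 3!big_split /= !pick ?(ltnW k1) //.
  have -> : \sum_(i < k) r i * (2 * ((1 - q) * q ^+ i)) = 2 * (1 - q) * (\sum_(i < k) q ^+ i * r i).
    by rewrite mulr_sumr; apply: eq_bigr => i _; ring.
  have E (a : R) : \sum_(i < k) r i * a = a by rewrite -mulr_suml r1 mul1r.
  by rewrite !E.
have : (1 + q ^+ k) * (1 + \sum_(i < k) r i ^+ 2) <= (1 + q ^+ k) * (1 + r 0%N).
  by rewrite ler_wpM2l ?lerD2l // addr_ge0.
lra.
Qed.

(** Cost per vertex of [H] when a fraction [(1 - q) * q ^+ i] has colour [i] and pays [u i], and the
    uncoloured fraction [q ^+ k] pays for both lightest vertices. *)
Definition clique_cost (u : nat -> R) k : R :=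
  \sum_(i < k) (1 - q) * q ^+ i * u i + q ^+ k * (u 0%N + u 1%N).

(** Substituting [q * u i = c - r i] turns [q * clique_cost u k] into [c * (1 + q ^+ k)] minus the
    linear form of [clique_inequality]; then the positive factor [1 + q ^+ k] cancels. *)
Lemma critical_level (c : R) (u r : nat -> R) k : (1 < k)%N ->
  (forall i, (i < k)%N -> 0 <= r i) ->
  (forall i, (i.+1 < k)%N -> r i.+1 <= r i) ->
  \sum_(i < k) r i = 1 ->
  (forall i, (i < k)%N -> q * u i = c - r i) ->
  1 <= clique_cost u k -> 1 + \sum_(i < k) r i ^+ 2 <= 2 * c.
Proof.
move: q_half q_le1 => hq hq1.
move=> k1 r0 rdec r1 ur f1.
have := clique_inequality k1 r0 rdec r1.
have : q * 1 <= q * clique_cost u k by rewrite ler_wpM2l.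
have -> : q * clique_cost u k = c * (1 + q ^+ k) - (1 - q) * (\sum_(i < k) q ^+ i * r i)
    - q ^+ k * (r 0%N + r 1%N).
  rewrite /clique_cost mulrDr mulr_sumr.
  have -> : \sum_(i < k) q * ((1 - q) * q ^+ i * u i)
      = c * (1 - q ^+ k) - (1 - q) * (\sum_(i < k) q ^+ i * r i).
    rewrite -sum_geometric !mulr_sumr -sumrB; apply: eq_bigr => i _.
    by rewrite mulrCA ur //; ring.
  rewrite [q * (q ^+ k * _)]mulrCA [q * (_ + _)]mulrDr !ur ?(ltnW k1) //; ring.
rewrite mulr1 => A B; rewrite -(@ler_pM2l _ (1 + q ^+ k)); last first.
  by rewrite ltr_wpDr.
lra.
Qed.

End CliqueInequality.

Section WeightedTuran.
Variables (R : realFieldType) (G : sgraph) (w : G -> R) (q : R).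
Hypothesis q_half : 1 <= 2 * q.
Hypothesis q_le1 : q <= 1.
Hypothesis w_ge0 : forall x, 0 <= w x.

Definition sorted_clique (x : nat -> G) k :=
  (forall i j, (i < k)%N -> (j < k)%N -> i != j -> adj (x i) (x j)) /\
  (forall i j, (i <= j)%N -> (j < k)%N -> w (x i) <= w (x j)).

Lemma sorted_clique_enum (S : {set G}) x0 :
  {in S &, forall x y, x != y -> adj x y} ->
  let s := sort (fun a b => w a <= w b) (enum S) in
  sorted_clique (nth x0 s) #|S| /\
  forall F : G -> R, \sum_(i < #|S|) F (nth x0 s i) = \sum_(x in S) F x.
Proof.
move=> Sadj s; have sz : size s = #|S| by rewrite size_sort cardE.
have s_in y : y \in s -> y \in S by rewrite mem_sort mem_enum.
have s_uniq : uniq s by rewrite sort_uniq enum_uniq.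
split; [split|] => [i j ik jk ij|i j ij jk|F].
- by apply: Sadj; rewrite ?s_in ?mem_nth ?sz // nth_uniq ?sz.
- have tot : total (fun a b : G => w a <= w b) by move=> a b; apply: le_total.
  have tr : transitive (fun a b : G => w a <= w b) by move=> b a c; apply: le_trans.
  have rf : reflexive (fun a b : G => w a <= w b) by move=> a; apply: lexx.
  by apply: (sorted_leq_nth tr rf x0 (sort_sorted tot _)); rewrite ?inE ?sz // (leq_ltn_trans ij).
rewrite -sz -(big_mkord xpredT (fun i => F (nth x0 s i))) -(big_nth x0 xpredT F).
by rewrite (perm_big (enum S)) ?big_enum // perm_sort.
Qed.

Hypothesis heavy_cliques : forall x k, (1 < k)%N -> sorted_clique x k ->
  1 <= clique_cost q (fun i => w (x i)) k.

(* [c] is the level for which [r] maximises [(1 - |r|^2) / 2 - q * <w, r>] over the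
   probability distributions supported on the clique [T]; the support of the maximiser
   is the subset minimising the average [(1 + q * w(S)) / |S|]. *)
Lemma clique_support (T : {set G}) : T != set0 ->
  {in T &, forall x y, x != y -> adj x y} ->
  exists (c : R) (r : G -> R),
    (forall x, x \in T -> c - r x <= q * w x) /\ 1 + \sum_x r x ^+ 2 <= 2 * c.
Proof.
move=> Tn0 Tadj.
pose lvl (S : {set G}) : R := (1 + q * \sum_(x in S) w x) / #|S|%:R.
have TT : (T \subset T) && (T != set0) by rewrite subxx.
case: (@arg_minP _ _ _ T (fun S : {set G} => (S \subset T) && (S != set0)) lvl TT).
move=> S /andP[ST Sn0] Smin; set c := lvl S in Smin.
have Sgt0 : (0 < #|S|)%N by rewrite card_gt0.
have cS : c * #|S|%:R = 1 + q * \sum_(x in S) w x.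
  by rewrite /c /lvl divfK // pnatr_eq0 -lt0n.
(* Deleting [x] from [S] cannot lower the minimal average [c]; likewise, below, adding a vertex of
   [T] outside [S] cannot. *)
have in_le x : x \in S -> q * w x <= c.
  move=> xS; have Sx := cardsD1 x S; rewrite xS in Sx.
  have sumS : \sum_(y in S) w y = w x + \sum_(y in S :\ x) w y by rewrite (big_setD1 x).
  have [S1|S1] := posnP #|S :\ x|.
    move: cS; rewrite sumS (cards0_eq S1) big_set0 Sx S1 /= mulr1; lra.
  have := Smin (S :\ x); rewrite -card_gt0 S1 (subset_trans (subsetDl _ _)) //= => /(_ isT).
  rewrite /lvl ler_pdivlMr ?ltr0n //; move: cS.
  rewrite sumS Sx natrD /=; lra.
have out_ge x : x \in T -> x \notin S -> c <= q * w x.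
  move=> xT xS; have Sx := cardsU1 x S; rewrite xS /= in Sx.
  have sumS : \sum_(y in x |: S) w y = w x + \sum_(y in S) w y by rewrite big_setU1.
  have := Smin (x |: S); rewrite -card_gt0 Sx subUset sub1set xT ST /= => /(_ isT).
  rewrite /lvl ler_pdivlMr ?ltr0n // ?Sx //; move: cS.
  rewrite sumS natrD /=; lra.
pose r x := if x \in S then c - q * w x else 0.
exists c, r; split=> [x xT|].
  rewrite /r; case: ifPn => xS; first lra.
  by rewrite subr0 out_ge.
have [x0 x0S] := set0Pn _ Sn0.
have [x_clique x_sum] := sorted_clique_enum x0 (sub_in2 (subsetP ST) Tadj).
set x := nth x0 _ in x_clique x_sum.
have rE (F : R -> R) : F 0 = 0 -> \sum_y F (r y) = \sum_(i < #|S|) F (c - q * w (x i)).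
  move=> F0; rewrite (x_sum (fun y => F (c - q * w y))) [RHS]big_mkcond.
  by apply: eq_bigr => y _; rewrite /r; case: ifP.
rewrite (rE (fun a => a ^+ 2)) ?expr0n //.
have r1 : \sum_(i < #|S|) (c - q * w (x i)) = 1.
  rewrite (x_sum (fun y => c - q * w y)) sumrB sumr_const -mulr_natr cS -mulr_sumr.
  by rewrite addrK.
have [x_adj x_sorted] := x_clique.
have xS i : (i < #|S|)%N -> x i \in S.
  move=> iS; rewrite -mem_enum -(mem_sort (fun a b => w a <= w b)).
  by apply: mem_nth; rewrite size_sort -cardE.
have r0 i : (i < #|S|)%N -> 0 <= c - q * w (x i) by move=> /xS/in_le; rewrite subr_ge0.
(* A singleton is no heavy clique, but there [c = 1 + q * w x] and [r = 1] at its vertex, so the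
   bound is direct. *)
have [S1|] := ltnP 1 #|S|; last first.
  case: #|S| Sgt0 r1 r0 => [|[|]] // _; rewrite !big_ord1 => r1 _; rewrite r1 expr1n.
  have : 0 <= q * w (x (ord0 : 'I_1)) by rewrite mulr_ge0 //; move: q_half => ?; lra.
  lra.
apply: (@critical_level _ q q_half q_le1 c (fun i => w (x i)) (fun i => c - q * w (x i)) #|S|) => //.
- move=> i iS; rewrite lerD2l lerN2; apply: ler_wpM2l; last exact: x_sorted.
  by move: q_half => ?; lra.
- by move=> i _; ring.
- exact: heavy_cliques.
Qed.

Lemma sum_indicator (x : G) (F : G -> R) : \sum_a (a == x)%:R * F a = F x.
Proof.
rewrite (bigD1 x) //= eqxx mul1r big1 ?addr0 // => a /negPf->; exact: mul0r.
Qed.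

(** Induction on the support of [p]. On a clique, expanding [0 <= |p - r|^2] with [c] and [r] from
    [clique_support] gives the bound. Otherwise the support has nonadjacent [x] and [y]; as
    [p x * p y] does not occur, left minus right side is linear in mass moved between them, so one
    of the two can be emptied without decreasing it. *)
Lemma weighted_turan (p : G -> R) : (forall x, 0 <= p x) -> \sum_x p x = 1 ->
  \sum_x \sum_y (adj x y)%:R * p x * p y <= 2 * q * \sum_x w x * p x.
Proof.
have [n] := ubnP #|[set x | p x != 0]|; elim: n p => // n IH p pn p0 p1.
set T := [set x | p x != 0] in pn.
have [/exists_inP[x xT /exists_inP[y yT /andP[xy nxy]]]|] :=
  boolP [exists x in T, exists y in T, (x != y) && ~~ adj x y]; last first.
  rewrite negb_exists_in => /forall_inP T_clique.
  have Tadj : {in T &, forall x y, x != y -> adj x y}.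
    move=> x y xT yT xy; have := T_clique x xT; rewrite negb_exists_in.
    by move=> /forall_inP/(_ y yT); rewrite xy negbK.
  have Tn0 : T != set0.
    apply/eqP => T0; move/eqP: p1; rewrite big1 ?(eq_sym 0) ?oner_eq0 // => x _.
    by apply/eqP; have := in_set0 x; rewrite -T0 inE => /negbFE.
  have [c [r [cr rc]]] := clique_support Tn0 Tadj.
  have le_sq : \sum_x \sum_y (adj x y)%:R * p x * p y <= 1 - \sum_x p x ^+ 2.
    have -> : 1 - \sum_x p x ^+ 2 = \sum_x \sum_y (x != y)%:R * p x * p y.
      transitivity ((\sum_x p x) * (\sum_x p x) - \sum_x p x ^+ 2); first by rewrite p1 mulr1.
      rewrite mulr_suml -sumrB; apply: eq_bigr => x _.
      rewrite mulr_sumr (bigD1 x) //= [in RHS](bigD1 x) //= eqxx !mul0r add0r.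
      rewrite -expr2 addrAC subrr add0r; apply: eq_bigr => y yx.
      by rewrite eq_sym yx mul1r.
    apply: ler_sum => x _; apply: ler_sum => y _; rewrite !ler_wpM2r // ler_nat.
    by case: eqP => [->|_]; rewrite ?adj_irrefl // leq_b1.
  have sq_ge0 : 0 <= \sum_x (p x - r x) ^+ 2 by apply: sumr_ge0 => x _; apply: sqr_ge0.
  have sqE : \sum_x (p x - r x) ^+ 2 = \sum_x p x ^+ 2 + \sum_x r x ^+ 2
      - 2 * \sum_x r x * p x.
    by rewrite mulr_sumr -big_split -sumrB /=; apply: eq_bigr => x _; ring.
  have : c - \sum_x r x * p x <= q * \sum_x w x * p x.
    rewrite -[c]mulr1 -p1 !mulr_sumr -sumrB; apply: ler_sum => x _.
    rewrite -mulrBl mulrA; have [->|px] := eqVneq (p x) 0; first by rewrite !mulr0.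
    by apply: ler_wpM2r => //; apply: cr; rewrite inE.
  lra.
pose N a := \sum_b (adj a b)%:R * p b.
(* Moving mass [p y] from [y] to [x] changes left minus right side by [2 * p y] times this quantity;
   if it is negative, the roles of [x] and [y] are exchanged. *)
wlog D : x y xT yT xy nxy / 0 <= N x - N y - q * (w x - w y).
  move=> W; have [D|D] := leP 0 (N x - N y - q * (w x - w y)); first exact: (W x y).
  by apply: (W y x) => //; rewrite 1?eq_sym 1?adj_sym //; lra.
pose d a : R := (a == x)%:R - (a == y)%:R.
have dE (F : G -> R) : \sum_a d a * F a = F x - F y.
  by rewrite -[F x]sum_indicator -[F y]sum_indicator -sumrB; apply: eq_bigr => a _; rewrite mulrBl.
pose p' a := p a + p y * d a.
have p'0 a : 0 <= p' a.
  rewrite /p' /d; have [->|ay] := eqVneq a y; first by rewrite [y == x]eq_sym (negPf xy) sub0r mulrN1 subrr.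
  by rewrite subr0 addr_ge0 ?mulr_ge0.
have p'1 : \sum_a p' a = 1.
  rewrite big_split /= p1 -mulr_sumr.
  by under [X in _ * X]eq_bigr => a _ do rewrite -[d a]mulr1; rewrite dE subrr mulr0 addr0.
have p'n : (#|[set a | p' a != 0%R]| < n)%N.
  rewrite -ltnS; apply: leq_trans pn; rewrite ltnS; apply: proper_card.
  apply/properP; split; last first.
    by exists y => //; rewrite inE negbK /p' /d eqxx [y == x]eq_sym (negPf xy) sub0r mulrN1 subrr eqxx.
  apply/subsetP => a; rewrite !inE /p' /d; have [->|ax] := eqVneq a x; first by rewrite inE in xT.
  have [->|ay] := eqVneq a y; first by rewrite inE in yT.
  by rewrite subrr mulr0 addr0.
have := IH p' p'n p'0 p'1.
have -> : \sum_a w a * p' a = \sum_a w a * p a + p y * (w x - w y).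
  by rewrite -dE mulr_sumr -big_split /=; apply: eq_bigr => a _; rewrite /p'; ring.
have -> : \sum_a \sum_b (adj a b)%:R * p' a * p' b =
    \sum_a \sum_b (adj a b)%:R * p a * p b + 2 * p y * (N x - N y).
  have -> : \sum_a \sum_b (adj a b)%:R * p' a * p' b = \sum_a p' a * (N a + p y * ((adj a x)%:R - (adj a y)%:R)).
    apply: eq_bigr => a _; rewrite -(dE (fun b => (adj a b)%:R)) mulr_sumr /N -big_split mulr_sumr.
    by apply: eq_bigr => b _; rewrite /p' /=; ring.
  under eq_bigr => a _ do rewrite mulrDl -mulrA.
  rewrite big_split -mulr_sumr dE /= !adj_irrefl (adj_sym y x) (negPf nxy) subrr mulr0 !addr0.
  under eq_bigr => a _ do rewrite mulrDr.
  rewrite big_split /=.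
  have -> : \sum_a p a * (p y * ((adj a x)%:R - (adj a y)%:R)) = p y * (N x - N y).
    rewrite /N -sumrB mulr_sumr; apply: eq_bigr => a _; rewrite ![adj a _]adj_sym; ring.
  have -> : \sum_a p a * N a = \sum_a \sum_b (adj a b)%:R * p a * p b.
    by apply: eq_bigr => a _; rewrite mulr_sumr; apply: eq_bigr => b _; ring.
  ring.
have : 0 <= p y * (N x - N y - q * (w x - w y)) by rewrite mulr_ge0.
lra.
Qed.

End WeightedTuran.

(** * Cheap models *)

Section JumbledCost.
Variables (R : realFieldType) (H : sgraph) (q : R).
Hypothesis q_half : 1 <= 2 * q.
Hypothesis q_le1 : q <= 1.
Hypothesis large_independent : forall S : {set H},
  exists I : {set H}, [/\ I \subset S, independent I & (1 - q) * #|S|%:R <= #|I|%:R].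

Let q_ge0 : 0 <= q. Proof. by move: q_half => ?; lra. Qed.

(* Colour [k] means uncoloured. *)
Lemma geometric_colouring k : exists col : H -> nat,
  (forall u v, adj u v -> col u = col v -> (k <= col u)%N) /\
  (forall i, (i <= k)%N -> #|[set h | (i <= col h)%N]|%:R <= q ^+ i * #|H|%:R).
Proof.
elim: k => [|k [col [col_proper col_tail]]].
  exists (fun=> 0%N); split=> // i; rewrite leqn0 => /eqP->.
  by rewrite expr0 mul1r ler_nat max_card.
set S := [set h | (k <= col h)%N].
have [I [IS Iind Icard]] := large_independent S.
have SE h : (h \in S) = (k <= col h)%N by rewrite inE.
(* Colour [k], so far the mark of uncoloured vertices, becomes a real colour on [I]; the rest of [S]
   gets the new mark [k.+1]. *)
pose col' h := if h \in S then (if h \in I then k else k.+1) else col h.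
exists col'; split=> [u v uv|i ik].
  rewrite /col'; case: (boolP (u \in S)) => uS; case: (boolP (v \in S)) => vS.
  - case: (boolP (u \in I)) => uI; case: (boolP (v \in I)) => vI; try by lia.
    move=> _; by move/forall_inP: Iind => /(_ u uI)/forall_inP/(_ v vI); rewrite uv.
  - by rewrite SE in vS; case: ifP => _; lia.
  - by rewrite SE in uS; case: ifP => _; lia.
  - by move/(col_proper _ _ uv) => ku; rewrite SE ku in uS.
have [ik'|ki] := leqP i k.
  apply: le_trans (col_tail i ik'); rewrite ler_nat subset_leq_card //.
  apply/subsetP => h; rewrite !inE /col'; case: ifP => //; rewrite SE => kh _.
  exact: leq_trans kh.
have -> : i = k.+1 by lia.
have -> : [set h | (k < col' h)%N] = S :\: I.
  apply/setP => h; rewrite in_setD [h \in [set _ | _]]inE /col' SE.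
  case: (leqP k (col h)) => kh; last by rewrite andbF; lia.
  by case: (h \in I); rewrite ?ltnn ?ltnSn.
have cS := col_tail k (leqnn k); rewrite -/S in cS.
rewrite cardsD (setIidPr IS) natrB ?subset_leq_card // exprS -mulrA.
have := ler_wpM2l q_ge0 cS; lra.
Qed.

(** Layer-cake form of a cost: summed over the vertices of [H], it involves the colouring only
    through its tail counts. *)
Lemma sum_telescope_cap (u : nat -> R) c k :
  \sum_(i < k) (i < c)%:R * (u i.+1 - u i) = u (minn c k) - u 0%N.
Proof.
elim: k => [|k IH]; first by rewrite big_ord0 minn0 subrr.
rewrite big_ord_recr /= IH; case: (ltnP k c) => kc.
  by rewrite mul1r (minn_idPr kc); ring.
by rewrite mul0r addr0 (minn_idPl (leqW kc)).
Qed.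

(** Summation by parts, passing from the tail bounds [q ^+ i.+1] to the layer sizes
    [(1 - q) * q ^+ i] of [clique_cost]. *)
Lemma abel_geometric (u : nat -> R) k :
  u 0%N + \sum_(i < k) q ^+ i.+1 * (u i.+1 - u i)
  = \sum_(i < k) (1 - q) * q ^+ i * u i + q ^+ k * u k.
Proof.
elim: k => [|k IH]; first by rewrite !big_ord0 expr0; ring.
rewrite big_ord_recr [in RHS]big_ord_recr /= addrA IH exprS; ring.
Qed.

Definition model_cost (G : sgraph) (w : G -> R) (mu : {ffun H -> {set G}}) : R :=
  \sum_v \sum_(y in mu v) w y.

(* A vertex of colour [i] is placed on [x i], unless the pair [{x 0, x 1}] is lighter;
   the uncoloured vertices are placed on this pair, which is adjacent to everything. *)
Lemma clique_model (G : sgraph) (w : G -> R) x k : (forall y, 0 <= w y) ->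
  (1 < k)%N -> sorted_clique w x k ->
  exists mu : {ffun H -> {set G}}, jumbled_model mu /\
    model_cost w mu <= #|H|%:R * clique_cost q (fun i => w (x i)) k.
Proof.
move=> w0 k1 [x_adj x_sorted]; have k0 := ltnW k1.
have [col [col_proper col_tail]] := geometric_colouring k.
pose s := w (x 0%N) + w (x 1%N).
pose single i := (i < k)%N && (w (x i) <= s).
pose mu : {ffun H -> {set G}} :=
  [ffun h => if single (col h) then [set x (col h)] else [set x 0%N; x 1%N]].
have x01 : adj (x 0%N) (x 1%N) by apply: x_adj.
(* The price of colour [i] is [w (x i)] capped at [s]. The cap makes [u] nondecreasing up to
   [u k = s], so the tail bounds may be applied to nonnegative increments. *)
pose u i := if single i then w (x i) else s.
have far i : (i < k)%N -> exists y, y \in [set x 0%N; x 1%N] /\ adj y (x i).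
  move=> ik; case: i ik => [|i] ik; [exists (x 1%N) | exists (x 0%N)].
    by rewrite !inE eqxx orbT adj_sym.
  by rewrite !inE eqxx x_adj.
have uk i : (k <= i)%N -> u i = s by move=> ki; rewrite /u /single ltnNge ki.
have u_le i : (i < k)%N -> u i <= w (x i).
  by move=> ik; rewrite /u /single ik /=; case: ifPn; rewrite ?lexx // -ltNge => /ltW.
have u_mono i : u i <= u i.+1.
  rewrite /u /single; case: (ltnP i.+1 k) => [ik|ki] /=.
    rewrite (ltnW ik) /=; have h := x_sorted i i.+1 (leqnSn i) ik.
    by case: (leP (w (x i)) s) => h1; case: (leP (w (x i.+1)) s) => h2 /=; lra.
  by case: (i < k)%N => //=; case: (leP (w (x i)) s).
exists mu; split.
  apply/jumbledP; split=> [h|h g hg]; rewrite !ffunE.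
    by case: ifP => _; [apply: induced_connected1 | apply: induced_connected2].
  case: ifPn => [/andP[hk _]|_]; case: ifPn => [/andP[gk _]|_].
  - exists (x (col h)), (x (col g)); rewrite !inE !eqxx; split=> //.
    apply: x_adj => //; apply/eqP => /(col_proper _ _ hg).
    by rewrite leqNgt hk.
  - have [y [yin yadj]] := far _ hk; exists (x (col h)), y.
    by rewrite yin inE eqxx adj_sym.
  - by have [y [yin yadj]] := far _ gk; exists y, (x (col g)); rewrite yin inE eqxx.
  - by exists (x 0%N), (x 1%N); rewrite !inE !eqxx orbT.
have cost_u h : \sum_(y in mu h) w y = u (minn (col h) k).
  have -> : u (minn (col h) k) = u (col h).
    by case: (leqP (col h) k) => // kc; rewrite !uk // ltnW.
  rewrite ffunE /u; case: ifP => _; first by rewrite big_set1.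
  by rewrite big_setU1 ?big_set1 // inE; apply: contraTneq x01 => ->; rewrite adj_irrefl.
have -> : model_cost w mu =
    #|H|%:R * u 0%N + \sum_(i < k) #|[set h | (i < col h)%N]|%:R * (u i.+1 - u i).
  rewrite /model_cost; under eq_bigr => h _ do rewrite cost_u -[u _](subrK (u 0%N))
    -(sum_telescope_cap u (col h) k).
  rewrite big_split /= sumr_const addrC mulr_natl; congr (_ + _).
  rewrite exchange_big; apply: eq_bigr => i _; rewrite -mulr_suml; congr (_ * _).
  by rewrite -sum1_card natr_sum [RHS]big_mkcond; apply: eq_bigr => h _; rewrite inE; case: (_ < _)%N.
apply: (@le_trans _ _ (#|H|%:R * (u 0%N + \sum_(i < k) q ^+ i.+1 * (u i.+1 - u i)))).
  rewrite mulrDr lerD2l mulr_sumr; apply: ler_sum => i _; rewrite mulrA.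
  by apply: ler_wpM2r; rewrite ?subr_ge0 // mulrC; apply: col_tail.
apply: ler_wpM2l => //; rewrite abel_geometric (uk k) // lerD2r.
apply: ler_sum => i _; apply: ler_wpM2l; last exact: u_le.
by rewrite mulr_ge0 ?exprn_ge0 // subr_ge0.
Qed.

(** Take a cheapest model and let [m] be its cost per vertex of [H]. By [clique_model] every clique
    is heavy for the weights [w / m], so [weighted_turan] for the uniform distribution bounds the
    number of edges. *)
Lemma cheap_model (G : sgraph) (w : G -> R) : (0 < #|H|)%N ->
  (forall x, 0 <= w x) -> (0 < #|edges G|)%N ->
  exists mu : {ffun H -> {set G}}, jumbled_model mu /\
    model_cost w mu * #|edges G|%:R <= q * #|H|%:R * #|G|%:R * \sum_x w x.
Proof.
move=> H0 w0 e0.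
have [_ /imsetP[[a b] ab _]] := card_gt0P e0.
rewrite inE /= in ab.
(* Placing all of [H] on one edge shows that models exist, so a cheapest one can be chosen. *)
have mu0 : jumbled_model ([ffun=> [set a; b]] : {ffun H -> {set G}}).
  apply/jumbledP; split=> [v|u v _]; first by rewrite ffunE induced_connected2.
  by exists a, b; rewrite !ffunE !inE !eqxx orbT.
have [mu jmu mu_min] := arg_minP (model_cost w) mu0.
exists mu; split=> //.
have H0R : 0 < #|H|%:R :> R by rewrite ltr0n.
set m := model_cost w mu / #|H|%:R.
have mE : model_cost w mu = m * #|H|%:R by rewrite divfK // gt_eqF.
clearbody m.
have [m0|m0] := leP m 0.
  apply: (@le_trans _ _ 0).
    by rewrite mE; apply: mulr_le0_ge0 => //; apply: mulr_le0_ge0.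
  by rewrite !mulr_ge0 // sumr_ge0.
have n0 : 0 < #|G|%:R :> R by rewrite ltr0n; apply/card_gt0P; exists a.
have wm0 x : 0 <= w x / m by rewrite divr_ge0 ?(ltW m0).
have heavy x k : (1 < k)%N -> sorted_clique (fun x => w x / m) x k ->
    1 <= clique_cost q (fun i => w (x i) / m) k.
  move=> k1 [x_adj x_sorted].
  have xw : sorted_clique w x k.
    by split=> // i j ij jk; have := x_sorted i j ij jk; rewrite ler_pM2r // invr_gt0.
  have [nu [jnu nu_cost]] := clique_model w0 k1 xw.
  have := le_trans (mu_min _ jnu) nu_cost.
  rewrite mE mulrC ler_pM2l // => mf; rewrite -(@ler_pM2r _ m) // mul1r.
  apply: le_trans mf _; rewrite le_eqVlt; apply/orP; left; apply/eqP.
  rewrite /clique_cost mulrDl mulr_suml; congr (_ + _).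
    by apply: eq_bigr => i _; field; rewrite gt_eqF.
  by field; rewrite gt_eqF.
pose p (x : G) : R := #|G|%:R^-1.
have p1 : \sum_x p x = 1.
  by rewrite /p sumr_const -[LHS]mulr_natr mulVf // gt_eqF.
have := weighted_turan q_half q_le1 wm0 heavy (p := p) (fun=> ltac:(by rewrite invr_ge0)) p1.
have -> : \sum_x \sum_y (adj x y)%:R * p x * p y
    = #|[set e : G * G | adj e.1 e.2]|%:R / #|G|%:R ^+ 2.
  rewrite pair_big -sum1_card natr_sum mulr_suml [RHS]big_mkcond /=.
  apply: eq_bigr => e _; rewrite inE; case: (adj _ _); last by rewrite !mul0r.
  by rewrite !mul1r -invfM.
have -> : \sum_x w x / m * p x = (\sum_x w x) / (m * #|G|%:R).
  by rewrite mulr_suml; apply: eq_bigr => x _; rewrite /p invfM mulrA.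
have : 2 * #|edges G|%:R <= #|[set e : G * G | adj e.1 e.2]|%:R :> R.
  by rewrite -natrM ler_nat card_edges_adj.
set A := #|[set e : G * G | adj e.1 e.2]|%:R; set n := #|G|%:R in n0 *; set W := \sum_x w x.
set e := #|edges G|%:R => eA.
rewrite ler_pdivrMr ?exprn_gt0 // => B.
have : 2 * e * m <= 2 * q * (W / (m * n)) * n ^+ 2 * m.
  by rewrite ler_pM2r //; apply: le_trans B.
have -> : 2 * q * (W / (m * n)) * n ^+ 2 * m = 2 * (q * n * W).
  by field; rewrite !gt_eqF.
rewrite -mulrA ler_pM2l // => em.
by rewrite mE; have := ler_wpM2r (ltW H0R) em; lra.
Qed.

End JumbledCost.

From mathcomp Require Import boolp classical_sets reals constructive_ereal ereal.

(** * Fractional packings *)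

Section PackingDuality.
Variables (R : realType) (G H : sgraph).

Lemma model_cost_multiplicity (w : G -> R) (mu : {ffun H -> {set G}}) :
  model_cost w mu = \sum_x w x * (multiplicity mu x)%:R.
Proof.
rewrite /model_cost; under eq_bigr => v _ do rewrite big_mkcond.
rewrite exchange_big /=; apply: eq_bigr => x _.
rewrite /multiplicity -sum1_card natr_sum mulr_sumr [RHS]big_mkcond /=.
by apply: eq_bigr => v _; rewrite inE mulr1.
Qed.

Variable C : R.
Hypothesis C_ge0 : 0 <= C.
Hypothesis cheap : forall w : G -> R, (forall x, 0 <= w x) ->
  exists mu : {ffun H -> {set G}}, jumbled_model mu /\ model_cost w mu <= C * \sum_x w x.

Definition load (s : seq {ffun H -> {set G}}) x : R := \sum_(mu <- s) (multiplicity mu x)%:R.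

Definition excess N s x : R := Num.max 0 (load s x - N%:R * C).

(** The right side is the square of [Num.max 0 a + d], whose absolute value is at least
    [Num.max 0 (a + d)]. *)
Lemma sqr_pos_part_add (a d : R) :
  Num.max 0 (a + d) ^+ 2 <= Num.max 0 a ^+ 2 + 2 * (Num.max 0 a * d) + d ^+ 2.
Proof.
have -> : Num.max 0 a ^+ 2 + 2 * (Num.max 0 a * d) + d ^+ 2 = (Num.max 0 a + d) ^+ 2 by ring.
case: (leP 0 a) => a0; case: (leP 0 (a + d)) => ad; rewrite ?expr0n ?sqr_ge0 ?lexx //=.
by rewrite add0r ler_sqr ?nnegrE //; lra.
Qed.

(* Blackwell's approachability argument: choosing each model cheapest for the current
   excess keeps the squared norm of the excess growing only linearly. *)
Lemma greedy_packing N : exists s : seq {ffun H -> {set G}},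
  [/\ size s = N, all (@jumbled_model G H) s &
      \sum_x excess N s x ^+ 2 <= N%:R * (#|G|%:R * (#|H|%:R + C) ^+ 2)].
Proof.
elim: N => [|N [s [sN js se]]].
  exists [::]; split=> //; rewrite mul0r big1 // => x _.
  by rewrite /excess /load big_nil mul0r subrr maxxx expr0n.
have e0 x : 0 <= excess N s x by rewrite le_max lexx.
have [mu [jmu mu_cost]] := cheap e0.
exists (mu :: s); split=> /=; [by rewrite sN | by rewrite jmu |].
pose d x : R := (multiplicity mu x)%:R - C.
have stepE x : excess N.+1 (mu :: s) x = Num.max 0 (load s x - N%:R * C + d x).
  by rewrite /excess /load big_cons -natr1 /d; congr Num.max; ring.
have d_sq x : d x ^+ 2 <= (#|H|%:R + C) ^+ 2.
  have mH : (multiplicity mu x)%:R <= #|H|%:R :> R by rewrite ler_nat max_card.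
  have m0 : 0 <= (multiplicity mu x)%:R :> R by [].
  have h0 : 0 <= #|H|%:R :> R by [].
  rewrite /d -subr_ge0 subr_sqr mulr_ge0 //; move: C_ge0 => c0; lra.
apply: (@le_trans _ _ (\sum_x (excess N s x ^+ 2 + 2 * (excess N s x * d x) + d x ^+ 2))).
  by apply: ler_sum => x _; rewrite stepE sqr_pos_part_add.
rewrite !big_split /= -mulr_sumr.
(* The new model is cheap for the weights [excess N s], so the cross term is nonpositive. *)
have : \sum_x excess N s x * d x <= 0.
  under eq_bigr => x _ do rewrite mulrBr.
  rewrite sumrB -model_cost_multiplicity -mulr_suml; lra.
have : \sum_x d x ^+ 2 <= #|G|%:R * (#|H|%:R + C) ^+ 2.
  rewrite mulr_natl -sumr_const; apply: ler_sum => x _; exact: d_sq.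
rewrite -natr1; lra.
Qed.

(** For every [e > 0], sufficiently many greedy models, all with the same coefficient, form a
    packing of total weight [(C + e)^-1]. *)
Lemma inv_Vol_le : 0 < C -> ((Vol R H G)^-1 <= C%:E)%E.
Proof.
move=> C0; apply/lee_addgt0Pr => e e0; have Ce : 0 < C + e by rewrite addr_gt0.
have Ce_inv : ((C + e)^-1%:E <= Vol R H G)%E; last first.
  have V0 : (0%:E <= Vol R H G)%E by apply: le_trans Ce_inv; rewrite lee_fin invr_ge0 ltW.
  have := Ce_inv; rewrite -[X in (X <= _)%E -> _]inveK inver gt_eqF ?invr_gt0 // invrK => VC.
  rewrite -EFinD -(@lee_pV2 R) ?inE ?inve_ge0 ?lee_fin ?(ltW Ce) //.
  by rewrite inveK.
set M := #|G|%:R * (#|H|%:R + C) ^+ 2.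
(* With [n = N.+1] models the squared excess is at most [n * M], hence below [(n * e) ^+ 2], so
   every load is at most [n * (C + e)]. *)
have [N NM] : exists N : nat, M / e ^+ 2 < N.+1%:R.
  exists (Num.truncn (M / e ^+ 2)); exact: truncnS_gt.
rewrite ltr_pdivrMr ?exprn_gt0 // in NM.
have [s [sN js se]] := greedy_packing N.+1; rewrite -/M in se.
set n := N.+1 in sN se NM; have n0 : 0 < n%:R :> R by [].
pose a : R := (n%:R * (C + e))^-1.
have load_le x : load s x <= n%:R * (C + e).
  have : load s x - n%:R * C <= excess n s x by rewrite le_max lexx orbT.
  have : excess n s x <= n%:R * e; last lra.
  have ex0 : 0 <= excess n s x by rewrite le_max lexx.
  have ne0 : 0 <= n%:R * e by rewrite mulr_ge0 // ltW.
  rewrite -ler_sqr ?nnegrE //.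
  apply: (@le_trans _ _ (\sum_y excess n s y ^+ 2)).
    by rewrite (bigD1 x) //= lerDl sumr_ge0 // => y _; apply: sqr_ge0.
  by apply: le_trans se _; rewrite exprMn expr2 -mulrA ler_pM2l // ltW.
apply: ereal_sup_ubound; exists n, (fun=> a), (fun i => nth [ffun=> finset.set0] s i); split; last first.
  by rewrite sumr_const card_ord -mulr_natl /a invfM mulVKf // gt_eqF.
split=> [i|i|x].
- by rewrite invr_ge0 mulr_ge0 // ltW.
- by apply: (allP js); rewrite mem_nth // sN.
rewrite -mulr_sumr -ler_pdivlMl ?invr_gt0 ?mulr_gt0 // invrK mulr1.
apply: le_trans (load_le x).
by rewrite /load (big_nth [ffun=> finset.set0]) sN big_mkord.
Qed.

End PackingDuality.

(** * Bounds on [cf] and the equivalence *)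

Lemma Vol_star_le (R : realType) (H : sgraph) n :
  (Vol R H (star n) * (#|H| - alpha H)%:R%:E <= 1)%E.
Proof.
have [->|t0] := posnP (#|H| - alpha H); first by rewrite mule0 lee_fin.
have t0R : 0 < (#|H| - alpha H)%:R :> R by rewrite ltr0n.
rewrite -lee_pdivlMr // mul1e; apply: ge_ereal_sup => _ [m [a [mu [[a0 jmu mule1] ->]]]].
rewrite lee_fin -(@ler_pM2r _ (#|H| - alpha H)%:R) // mulVf ?gt_eqF //.
(* Only the packing constraint at the centre is used: each model meets it at least [#|H| - alpha H]
   times. *)
apply: le_trans (mule1 (None : option 'I_n)); rewrite mulr_suml.
by apply: ler_sum => i _; rewrite ler_wpM2l // ler_nat star_multiplicity.
Qed.

(** By [cheap_model] and duality the inverse volume is at most [q * #|H| * #|G| / #|edges G|], and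
    the density cancels the last two factors. Edgeless [G] contribute 0. *)
Lemma cf_upper_bound (R : realType) (H : sgraph) (q : R) :
  1 <= 2 * q -> q <= 1 -> (0 < #|H|)%N ->
  (forall S : {set H}, exists I : {set H},
     [/\ I \subset S, independent I & (1 - q) * #|S|%:R <= #|I|%:R]) ->
  (cf R H <= (q * #|H|%:R)%:E)%E.
Proof.
move=> hq hq1 H0 Hind; apply: ge_ereal_sup => _ [G [G0 ->]].
have [e0|e0] := posnP #|edges G|.
  by rewrite /density e0 mul0r mul0e lee_fin mulr_ge0 //; lra.
have n0 : 0 < #|G|%:R :> R by rewrite ltr0n.
have h0 : 0 < #|H|%:R :> R by rewrite ltr0n.
have eR : 0 < #|edges G|%:R :> R by rewrite ltr0n.
have q0 : 0 < q by lra.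
have C0 : 0 < q * #|H|%:R * #|G|%:R / #|edges G|%:R by rewrite divr_gt0 ?mulr_gt0.
have cheap (w : G -> R) : (forall x, 0 <= w x) -> exists mu : {ffun H -> {set G}},
    jumbled_model mu /\ model_cost w mu <= q * #|H|%:R * #|G|%:R / #|edges G|%:R * \sum_x w x.
  move=> w0; have [mu [jmu mu_cost]] := cheap_model hq hq1 Hind H0 w0 e0.
  by exists mu; rewrite mulrAC ler_pdivlMr.
have d0 : (0 <= (density R G)%:E)%E by rewrite lee_fin divr_ge0.
apply: le_trans (lee_wpmul2l d0 (inv_Vol_le (ltW C0) cheap C0)) _.
rewrite -EFinM lee_fin /density le_eqVlt; apply/orP; left; apply/eqP.
by field; rewrite !gt_eqF.
Qed.

(** The star with [n] leaves has density at least [n / n.+1] and inverse volume at least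
    [#|H| - alpha H]; then [n] tends to infinity. *)
Lemma cf_lower_bound (R : realType) (H : sgraph) (c : R) :
  (0 < #|H|)%N -> (cf R H <= c%:E)%E -> (#|H| - alpha H)%:R <= c.
Proof.
move=> H0 cfc; set a := (#|H| - alpha H)%N.
have bound n : a%:R * n%:R <= c * n.+1%:R.
  have V0 : (0 <= Vol R H (star n))%E.
    apply: ereal_sup_ubound; exists 0%N, (fun=> 0), (fun=> [ffun=> finset.set0]).
    by split; [split=> [[]|[]|x] //; rewrite big_ord0 | rewrite big_ord0].
  have cf_star : ((density R (star n))%:E / Vol R H (star n) <= c%:E)%E.
    by apply: le_trans cfc; apply: ereal_sup_ubound; exists (star n); rewrite card_star.
  have [->|a0] := posnP a.
    rewrite mul0r mulr_ge0 // -lee_fin; apply: le_trans cf_star.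
    by rewrite mule_ge0 ?inve_ge0 // lee_fin divr_ge0.
  have aR : 0 < a%:R :> R by rewrite ltr0n.
  have aV : (a%:R%:E <= (Vol R H (star n))^-1)%E.
    rewrite inve_pge ?inE ?lee_fin ?(ltW aR) // inver gt_eqF //.
    by rewrite -[leRHS]mul1e lee_pdivlMr // Vol_star_le.
  have : ((n%:R / n.+1%:R)%:E * a%:R%:E <= c%:E)%E.
    apply: le_trans cf_star; apply: lee_pmul; rewrite ?lee_fin ?divr_ge0 // /density card_star.
    by rewrite ler_pM2r ?invr_gt0 // ler_nat card_star_edges.
  by rewrite -EFinM lee_fin mulrAC ler_pdivrMr // mulrC.
rewrite leNgt; apply/negP => ca; have d0 : 0 < a%:R - c by rewrite subr_gt0.
(* The bound at [n] says [n * (a - c) <= c], which fails once [n] exceeds [c / (a - c)]. *)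
have := bound (Num.truncn (c / (a%:R - c))).+1.
have := truncnS_gt (c / (a%:R - c)); rewrite ltr_pdivrMr //.
rewrite -[_.+2%:R]natr1; lra.
Qed.

Theorem theorem8p3 (R : realType) (t : nat) (ht : (3 <= t)%N) :
  (forall H : sgraph, (0 < #|H|)%N -> ~ is_minor H (complete t) ->
     #|H|%:R / (t%:R - 1) <= (alpha H)%:R :> R)
  <->
  (forall F : graph_class, minor_closed F ->
     ~ (forall G : sgraph, bounded_components t G -> F G) ->
     (rho R F <= ((t%:R - 2) / (t%:R - 1))%:E)%E).
Proof.
have t3 : 3 <= t%:R :> R by rewrite ler_nat.
have t1 : 0 < t%:R - 1 :> R by lra.
have t0 : (0 < t)%N by apply: leq_trans ht.
have qE : 1 - (t%:R - 2) / (t%:R - 1) = (t%:R - 1)^-1 :> R by field; rewrite gt_eqF.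
split=> [large F Fminor FnotC|small H H0 HKt].
  apply: ge_ereal_sup => _ [H [Hnuc H0 ->]].
  have HKt : ~ is_minor H (complete t).
    (* Every [G] in [bounded_components t] is a minor of [#|G|] cliques, hence of [#|G|] copies of
       [H], which lie in [F]. *)
    move=> HKt; apply: FnotC => G /bounded_components_minor GKt.
    exact: Fminor (Fminor _ _ (Hnuc _) (copies_minor _ HKt)) GKt.
  rewrite inver pnatr_eq0 gtn_eqF // lee_pdivrMr ?ltr0n // -EFinM.
  apply: cf_upper_bound => // [||S].
  (* Here [t >= 3] enters: it gives [q >= 1/2]. *)
  - by rewrite mulrA ler_pdivlMr //; lra.
  - by rewrite ler_pdivrMr //; lra.
  have [I [IS Iind Icard]] := induced_independent S; exists I; split=> //.
  rewrite qE mulrC Icard; have [->|S0] := posnP #|S|; first by rewrite mul0r.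
  rewrite -(card_induced S); apply: large; first by rewrite card_induced.
  by move=> SKt; apply: HKt; apply: minor_trans (induced_minor S) SKt.
pose F : graph_class := fun G => ~ is_minor G (complete t).
have Fminor : minor_closed F by move=> G K FG GK KKt; apply: FG; apply: minor_trans GK KKt.
have FnotC : ~ (forall G : sgraph, bounded_components t G -> F G).
  (* The clique on [t] vertices witnesses the failure of inclusion. *)
  move=> /(_ (complete t)) FKt; apply: FKt (minor_refl _) => x.
  by apply: leq_trans (max_card _) _; rewrite /= card_ord.
have h0 : 0 < #|H|%:R :> R by rewrite ltr0n.
have : (cf R H / (#|H|%:R)%:E <= ((t%:R - 2) / (t%:R - 1))%:E)%E.
  apply: le_trans (small F Fminor FnotC); apply: ereal_sup_ubound; exists H; split=> // k kKt.
  by apply: HKt; apply: complete_minor_copies kKt t0.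
rewrite inver gt_eqF // lee_pdivrMr // -EFinM => /(cf_lower_bound H0).
have aH : (alpha H <= #|H|)%N by apply/bigmax_leqP => S _; apply: max_card.
rewrite natrB // => h; rewrite mulrC -qE; lra.
Qed.
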